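(* For every $a>0$, one has the identity in law $$\mathbf{B}'_{a,1/2}+\mathbf{B}'_{a,1/2}\;\stackrel{d}{=}\;\mathbf{B}'_{2a,1/2}\times\left(1+\sqrt{\mathbf{B}_{a,1/2}}\right),$$ where all random variables appearing on the same side of the identity are independent.
   Context: For $p,q>0$, $\mathbf{B}_{p,q}$ denotes a beta random variable with density $\frac{\Gamma(p+q)}{\Gamma(p)\Gamma(q)}x^{p-1}(1-x)^{q-1}$ on $(0,1)$, and $\mathbf{B}'_{p,q}$ denotes a beta prime random variable with density $\frac{\Gamma(p+q)}{\Gamma(p)\Gamma(q)}\frac{x^{p-1}}{(1+x)^{p+q}}$ on $(0,\infty)$. $X\stackrel{d}{=}Y$ means $X$ and $Y$ have the same distribution. *)

(* Defs.v *)
From HB Require Import structures.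
From mathcomp Require Import all_boot all_order all_algebra.
From mathcomp Require Import all_classical all_reals all_analysis.
Set Implicit Arguments. Unset Strict Implicit. Unset Printing Implicit Defensive.
Import Order.TTheory GRing.Theory Num.Theory.
Import numFieldNormedType.Exports.
Local Open Scope classical_set_scope.
Local Open Scope ring_scope.

Definition Gamma {R : realType} (p : R) : R :=
  fine (\int[@lebesgue_measure R]_(x in `]0%R, +oo[)
          (powR x (p - 1) * expR (- x))%:E)%E.

Definition beta_density {R : realType} (p q : R) (x : R) : R :=
  if (0 < x) && (x < 1) then
    Gamma (p + q) / (Gamma p * Gamma q) * powR x (p - 1) * powR (1 - x) (q - 1)
  else 0.

Definition beta_prime_density {R : realType} (p q : R) (x : R) : R :=
  if 0 < x then
    Gamma (p + q) / (Gamma p * Gamma q) * powR x (p - 1) / powR (1 + x) (p + q)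
  else 0.

Definition has_density {d} {T : measurableType d} {R : realType}
  (P : probability T R) (X : T -> R) (f : R -> R) : Prop :=
  forall A : set R, measurable A ->
    P (X @^-1` A) = (\int[@lebesgue_measure R]_(x in A) (f x)%:E)%E.

Definition indep2 {d} {T : measurableType d} {R : realType}
  (P : probability T R) (X Y : T -> R) : Prop :=
  forall A B : set R, measurable A -> measurable B ->
    P (X @^-1` A `&` Y @^-1` B) = (P (X @^-1` A) * P (Y @^-1` B))%E.

(* Main.v *)
(* Both sides have a density proportional to
     s^(2a-1) (2+s)^(-2a) (1+s)^(-1/2)   on (0, oo),
   and since both are probability laws the two constants agree; no identity between
   Gamma factors is needed.

   For the sum, the convolution integral over x in (0, s) is rewritten with
   x = s/2 (1 + q / sqrt (1 + q^2)), q = k p, k = (2+s) / (2 sqrt (1+s)), which turns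
   the integrand into a function of p alone times the density above.  For the
   product, conditioning on the beta variable z gives an integral over z in (0, 1),
   and z = (k e^t / (1 + k e^t))^2 with k = (1+s) / (2+s) separates t from s in the
   same way. *)
Require Import Defs.
From HB Require Import structures.
From mathcomp Require Import all_boot all_order all_algebra.
From mathcomp Require Import all_classical all_reals all_analysis.
From mathcomp Require Import measurable_realfun ring lra.
Import Order.TTheory GRing.Theory Num.Theory.
Import numFieldNormedType.Exports.
Local Open Scope classical_set_scope.
Local Open Scope ring_scope.

Set Implicit Arguments. Unset Strict Implicit. Unset Printing Implicit Defensive.

(** * Laws with a density, and the joint law of an independent pair *)

(** The density makes [nu] dominated by Lebesgue measure; [f] and the Radon-Nikodym derivative have
    the same integral over every measurable set, hence agree almost everywhere. The bounds on [H]
    make it integrable for a probability. *)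
Lemma integral_with_density (R : realType) (nu : probability (measurableTypeR R) R)
    (f : R -> R) (H : R -> \bar R) :
  measurable_fun [set: R] f ->
  (forall A, measurable A -> nu A = \int[@lebesgue_measure R]_(x in A) (f x)%:E)%E ->
  measurable_fun [set: R] H -> (forall x, 0 <= H x <= 1)%E ->
  (\int[nu]_x H x = \int[@lebesgue_measure R]_x (H x * (f x)%:E))%E.
Proof.
move=> mf df mH H01.
have mEf : measurable_fun [set: R] (EFin \o f) by exact/measurable_EFinP.
have nu_dom : nu `<< @lebesgue_measure R.
  apply/null_content_dominatesP => A mA A0; rewrite (df _ mA).
  by apply: null_set_integral => //; exact: measurable_funTS.
rewrite -(Radon_Nikodym_change_of_variables nu_dom)//=; last first.
  apply/integrableP; split => //.
  apply: (@le_lt_trans _ _ (\int[nu]_x cst 1 x)%E).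
    apply: ge0_le_integral => //=; first exact: measurableT_comp.
    by move=> x _; have /andP[H0 H1] := H01 x; rewrite gee0_abs.
  by rewrite integral_cst//= mul1e probability_setT ltry.
apply: ae_eq_integral => //.
- exact: emeasurable_funM.
- exact: emeasurable_funM.
- apply: ae_eqe_mul2l => /=.
  rewrite Radon_NikodymE/=.
  case: cid => /= h [h1 h2 h3].
  apply: integral_ae_eq => //= E ET mE.
  by rewrite -h3//= df.
Qed.

(** Independence identifies the joint law with the product of the two marginals, whose value on [S]
    is the integral of the measures of its sections. *)
Lemma joint_law_density (R : realType) d (T : measurableType d)
    (P : probability T R) (X Y : {RV P >-> R}) (f g : R -> R) :
  measurable_fun [set: R] f -> measurable_fun [set: R] g ->
  has_density P X f -> has_density P Y g -> indep2 P X Y ->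
  forall S : set (measurableTypeR R * measurableTypeR R), measurable S ->
  P ((fun w => (X w, Y w)) @^-1` S) =
  (\int[@lebesgue_measure R]_x
    (\int[@lebesgue_measure R]_y ((\1_S (x, y) * g y)%:E) * (f x)%:E))%E.
Proof.
move=> mf mg dX dY XY S mS.
(* Lebesgue measure lives on [measurableTypeR R], whose display differs from the one
   of [R]; hence [X] and [Y] are repackaged with that codomain. *)
have mX : measurable_fun [set: T] (X : T -> measurableTypeR R).
  exact: (@measurable_funPT _ _ _ _ X).
have mY : measurable_fun [set: T] (Y : T -> measurableTypeR R).
  exact: (@measurable_funPT _ _ _ _ Y).
pose X' : {RV P >-> measurableTypeR R} :=
  HB.pack (X : T -> measurableTypeR R)
    (isMeasurableFun.Build _ _ _ (measurableTypeR R) _ mX).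
pose Y' : {RV P >-> measurableTypeR R} :=
  HB.pack (Y : T -> measurableTypeR R)
    (isMeasurableFun.Build _ _ _ (measurableTypeR R) _ mY).
have mXY : measurable_fun [set: T] (fun w => (X' w, Y' w)).
  exact: measurable_fun_pair.
pose XY' : {RV P >-> (measurableTypeR R * measurableTypeR R)%type} :=
  HB.pack (fun w => (X' w, Y' w)) (isMeasurableFun.Build _ _ _ _ _ mXY).
have -> : P ((fun w => (X w, Y w)) @^-1` S) = distribution P XY' S by [].
rewrite -(@product_measure_unique _ _ _ _ _ (distribution P X') (distribution P Y')
  (distribution P XY')) //=.
rewrite /product_measure1/=.
have mxs x : measurable (xsection S x) by exact: measurable_xsection.
rewrite (@integral_with_density _ _ f)//=.
- apply: eq_integral => x _; congr (_ * _)%E.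
  rewrite /distribution /pushforward [LHS]dY; last exact: mxs.
  rewrite integral_mkcond; apply: eq_integral => y _.
  by rewrite patchE/= indicE mem_xsection; case: ifPn; rewrite ?mul1r ?mul0r.
- exact: (measurable_fun_xsection (distribution P Y') mS).
- by move=> x; rewrite measure_ge0 probability_le1.
Qed.

(** * Changes of variables in Lebesgue integrals *)

(** Lebesgue measure is [k] times its own image under [x |-> k * x + b]; by uniqueness this needs
    checking on half-open intervals only. *)
Lemma ge0_integral_affine (R : realType) (k b : R) (g : R -> \bar R) :
  0 < k -> measurable_fun [set: R] g -> (forall x, 0 <= g x)%E ->
  (\int[@lebesgue_measure R]_x g (k * x + b)%R =
   \int[@lebesgue_measure R]_x (k^-1%:E * g x))%E.
Proof.
move=> k0 mg g0.
pose phi x : measurableTypeR R := k * x + b.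
have mphi : measurable_fun [set: R] phi.
  by apply: measurable_funD => //; exact: measurable_funM.
pose mphi_mixin := isMeasurableFun.Build _ _ (measurableTypeR R) _ _ mphi.
pose phip : {mfun (measurableTypeR R) >-> (measurableTypeR R)} := HB.pack phi mphi_mixin.
have kn0 : 0 <= k by exact: ltW.
have E A : measurable A -> @lebesgue_measure R A =
    mscale (NngNum kn0) (pushforward (@lebesgue_measure R) phip) A.
  move=> mA; apply: lebesgue_measure_unique => //= _ [[c d]] _ <-.
  rewrite /mscale/= /pushforward.
  have -> : phi @^-1` `]c, d] = `](c - b) / k, (d - b) / k]%classic.
    apply/seteqP; split => x /=; rewrite /phi !in_itv/=.
      by rewrite ltr_pdivrMr// ler_pdivlMr// ltrBlDr lerBrDr mulrC.
    by rewrite ltr_pdivrMr// ler_pdivlMr// ltrBlDr lerBrDr mulrC.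
  rewrite !lebesgue_measure_itv/= !lte_fin ltr_pM2r ?invr_gt0// ltrD2r.
  case: ifPn => _; last by rewrite mule0.
  by rewrite -!EFinB -EFinM; congr EFin; field; rewrite gt_eqF.
rewrite ge0_integralZl//; last by rewrite lee_fin invr_ge0.
rewrite (eq_measure_integral (mscale (NngNum kn0)
  (pushforward (@lebesgue_measure R) phip)))//; last first.
  by move=> A mA _; exact: E.
rewrite ge0_integral_mscale// ge0_integral_pushforward//= muleA -EFinM mulVf ?mul1e//.
by rewrite gt_eqF.
Qed.

(** Substitution holds on each segment [[-n, n]], with image [[F (-n), F n]], and monotone
    convergence passes to the limit on both sides. Surjectivity onto []l, r[] stands in for the
    limits of [F] at infinity. *)
Lemma ge0_integration_by_substitution_range (R : realType) (F F' G : R -> R)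
    (l r : R) :
  (forall x : R, is_derive x 1 F (F' x)) -> continuous F' ->
  (forall x, 0 < F' x) -> (forall x, l < F x < r) ->
  (forall y, l < y < r -> exists x, F x = y) ->
  {in `]l, r[, continuous G} -> {in `]l, r[, forall y, 0 <= G y} ->
  (\int[@lebesgue_measure R]_(y in `]l, r[) (G y)%:E =
   \int[@lebesgue_measure R]_x (G (F x) * F' x)%:E)%E.
Proof.
move=> dF cF' F'0 Flr Fsurj cG G0.
have F'E : derive1 F = F' by apply/funext => x; rewrite derive1E derive_val.
have cF : continuous F.
  by move=> x; apply/differentiable_continuous/derivable1_diffP; have [] := dF x.
have incF : {homo F : x y / x < y}.
  move=> x y xy; apply: (@gtr0_derive1_incr _ F x y) => //.
  - by move=> z _; rewrite F'E.
  - exact: continuous_subspaceT.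
have incF_le : {homo F : x y / x <= y}.
  by move=> x y; rewrite le_eqVlt => /predU1P[->//|/incF/ltW].
have Gin x y z : F x <= y <= F z -> y \in `]l, r[.
  have /andP[+ _] := Flr x; have /andP[_ +] := Flr z.
  move=> zr lx /andP[xy yz].
  by rewrite in_itv/= (lt_le_trans lx xy) (le_lt_trans yz zr).
have mG : measurable_fun `]l, r[ G.
  apply: open_continuous_measurable_fun; first exact: interval_open.
  by move=> x; rewrite inE/= => xlr; exact: cG.
have cGF : continuous (G \o F).
  by move=> x; apply: continuous_comp; [exact: cF|exact/cG/(Gin x _ x)/andP].
have mI (n : nat) : - n%:R <= n%:R :> R by rewrite (@le_trans _ _ 0) ?oppr_le0.
pose I (n : nat) : set R := `[- n%:R, n%:R]%classic.
pose J (n : nat) : set R := `[F (- n%:R), F n%:R]%classic.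
have JE : \bigcup_n J n = `]l, r[%classic.
  apply/seteqP; split => [y [n _]|y /= ylr].
    by rewrite /J/= in_itv/= => yn; exact: (Gin _ _ _ yn).
  have [x xy] := Fsurj y ylr.
  have : (\bigcup_n I n) x by rewrite /I (bigcup_itvT true false).
  move=> [n _]; rewrite /I/= in_itv/= => /andP[nx xn].
  by exists n => //; rewrite /J/= in_itv/= -xy !incF_le.
have cvgJ : (\int[@lebesgue_measure R]_(y in J n) (G y)%:E)%E @[n --> \oo] -->
    (\int[@lebesgue_measure R]_(y in `]l, r[) (G y)%:E)%E.
  rewrite -JE; apply: ge0_nondecreasing_set_cvg_integral => //.
  - move=> m n mn; apply/subsetPset => y; rewrite /J/= !in_itv/= => /andP[my ym].
    by rewrite (le_trans _ my) ?(le_trans ym)// incF_le// ?lerN2 ler_nat.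
  - by move=> n; exact: measurable_itv.
  - move=> n; apply/measurable_EFinP; apply: measurable_funS mG => //.
    by rewrite -JE; exact: bigcup_sup.
  - by move=> n y /=; rewrite /J/= in_itv/= => /Gin ylr; rewrite lee_fin G0.
have cvgI : (\int[@lebesgue_measure R]_(x in I n) (G (F x) * F' x)%:E)%E @[n --> \oo] -->
    (\int[@lebesgue_measure R]_x (G (F x) * F' x)%:E)%E.
  have <- : \bigcup_n I n = setT by rewrite /I (bigcup_itvT true false).
  apply: ge0_nondecreasing_set_cvg_integral => //.
  - move=> m n mn; apply/subsetPset => y; rewrite /I/= !in_itv/= => /andP[my ym].
    by rewrite (le_trans _ my) ?(le_trans ym)// ?lerN2 ler_nat.
  - by move=> n; exact: measurable_itv.
  - move=> n; apply/measurable_EFinP; apply: measurable_funTS.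
    by apply: measurable_funM; exact: continuous_measurable_fun.
  - move=> n x _; rewrite lee_fin mulr_ge0 ?(ltW (F'0 _))//.
    by rewrite G0//; exact: Flr.
apply: (cvg_unique _ cvgJ); first exact: ereal_hausdorff.
suff -> : (fun n => \int[@lebesgue_measure R]_(y in J n) (G y)%:E)%E =
  (fun n => \int[@lebesgue_measure R]_(x in I n) (G (F x) * F' x)%:E)%E by exact: cvgI.
apply/funext => n.
rewrite /J (@integration_by_substitution_increasing _ F)//.
- by apply: eq_integral => x _; rewrite F'E.
- by move=> x y _ _; exact: incF.
- by rewrite F'E => x _; exact: cF'.
- by rewrite F'E; apply: cvgP; exact/cvg_at_right_filter/cF'.
- by rewrite F'E; apply: cvgP; exact/cvg_at_left_filter/cF'.
- split.
  + by move=> x _.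
  + exact/cvg_at_right_filter/cF.
  + exact/cvg_at_left_filter/cF.
- apply: continuous_in_subspaceT => y; rewrite inE/= in_itv/= => /Gin.
  exact: cG.
Qed.

Lemma gt0_powRE (R : realType) (x r : R) : 0 < x -> x `^ r = expR (r * ln x).
Proof. by move=> x0; rewrite /powR gt_eqF. Qed.

Lemma is_derive_continuous (R : realType) (f f' : R -> R) :
  (forall x : R, is_derive x 1 f (f' x)) -> continuous f.
Proof.
move=> df x; apply/differentiable_continuous/derivable1_diffP.
by have [] := df x.
Qed.

(** * The substitution for the convolution integral *)

Section sum_substitution.
Context {R : realType} (s : R).
Hypothesis s0 : 0 < s.

Let k : R := (2 + s) / 2 * (1 + s) `^ (- 2^-1).

Let k0 : 0 < k.
Proof. by rewrite mulr_gt0 ?powR_gt0 ?divr_gt0 ?addr_gt0. Qed.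

Definition sum_subst (p : R) : R :=
  s / 2 * (1 + k * p * (1 + (k * p) ^+ 2) `^ (- 2^-1)).

Definition sum_subst' (p : R) : R :=
  s / 2 * k * (1 + (k * p) ^+ 2) `^ (- 2^-1 - 1).

Let Q0 p : 0 < 1 + (k * p) ^+ 2.
Proof. by rewrite ltr_pwDl// sqr_ge0. Qed.

Let is_derive_powQ (c p : R) :
  is_derive p 1 (fun p => (1 + (k * p) ^+ 2) `^ c)
    (c * (1 + (k * p) ^+ 2) `^ (c - 1) * (2 * k ^+ 2 * p)).
Proof.
have dQ : is_derive p 1 (fun p => 1 + (k * p) ^+ 2) (2 * k ^+ 2 * p).
  by apply: is_derive_eq; rewrite /GRing.scale/=; ring.
have := @is_derive1_comp _ (fun y => y `^ c) (fun p => 1 + (k * p) ^+ 2) p _ _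
  (is_derive1_powR _ (Q0 p)) dQ.
exact.
Qed.

Lemma is_derive_sum_subst (p : R) : is_derive p 1 sum_subst (sum_subst' p).
Proof.
have dP := is_derive_powQ (- 2^-1) p.
apply: is_derive_eq.
(* Once a common power of [Q = 1 + (k * p) ^+ 2] is factored out, the two terms of the product rule
   combine through [Q - (k * p) ^+ 2 = 1]. *)
have -> : (1 + (k * p) ^+ 2) `^ (- 2^-1) =
    (1 + (k * p) ^+ 2) * (1 + (k * p) ^+ 2) `^ (- 2^-1 - 1).
  move: (Q0 p); set Q := 1 + _ => Qp.
  rewrite (@powRB _ Q (- 2^-1) 1); last by rewrite (gt_eqF Qp) implybT.
  by rewrite powRr1 ?ltW// mulrCA divff ?mulr1// gt_eqF.
by rewrite /sum_subst' /GRing.scale/=; set w := _ `^ _; field.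
Qed.

Lemma continuous_sum_subst' : continuous sum_subst'.
Proof.
move=> p; apply: cvgM; first exact: cvg_cst.
exact: (is_derive_continuous (is_derive_powQ (- 2^-1 - 1))).
Qed.

Lemma sum_subst'_gt0 p : 0 < sum_subst' p.
Proof. by rewrite /sum_subst' !mulr_gt0 ?powR_gt0 ?Q0 ?addr_gt0. Qed.

Let sqr_powRN2V (x : R) : 0 < x -> (x `^ (- 2^-1)) ^+ 2 = x^-1.
Proof.
move=> x0; rewrite -powR_mulrn ?powR_ge0// -powRrM -[RHS]powR_inv1 ?ltW//.
by congr (_ `^ _); field.
Qed.

(** With [k * p = tan theta] this is [sin theta]: it ranges over []-1, 1[], and [sum_subst] is its
    affine image onto []0, s[]. *)
Let t_ p : R := k * p * (1 + (k * p) ^+ 2) `^ (- 2^-1).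

Let t_sqr p : t_ p ^+ 2 = 1 - (1 + (k * p) ^+ 2)^-1.
Proof.
rewrite /t_ exprMn sqr_powRN2V//; have := lt0r_neq0 (Q0 p).
by move: (k * p) => q ?; field.
Qed.

Lemma sum_subst_itv p : 0 < sum_subst p < s.
Proof.
have t1 : `|t_ p| < 1.
  rewrite -(@ltr_pXn2r _ 2)// ?nnegrE// real_normK ?num_real// t_sqr expr1n.
  by rewrite ltrBlDr ltrDl invr_gt0.
move: t1; rewrite ltr_norml => /andP[tN1 t1].
have sp := s0; rewrite /sum_subst -/(t_ p); apply/andP; split; nra.
Qed.

Lemma sum_subst_surj y : 0 < y < s -> exists p, sum_subst p = y.
Proof.
move=> /andP[y0 ys]; have sp := s0.
pose t := 2 * y / s - 1.
have ts : t * s = 2 * y - s by rewrite /t; field; rewrite gt_eqF.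
have t2 : 0 < 1 - t ^+ 2.
  have : 0 < s ^+ 2 * (1 - t ^+ 2).
    have -> : s ^+ 2 * (1 - t ^+ 2) = s ^+ 2 - (t * s) ^+ 2 by ring.
    by rewrite ts; nra.
  by rewrite pmulr_rgt0// exprn_gt0.
(* Inverse of [t_]: if [t = sin theta], then [tan theta = t / sqrt (1 - t ^+ 2)], and this equals
   [k * p]. *)
exists (t * (1 - t ^+ 2) `^ (- 2^-1) / k).
rewrite /sum_subst mulrCA divff ?gt_eqF// mulr1.
have -> : 1 + (t * (1 - t ^+ 2) `^ (- 2^-1)) ^+ 2 = (1 - t ^+ 2)^-1.
  by rewrite exprMn sqr_powRN2V//; field; rewrite gt_eqF.
have -> : ((1 - t ^+ 2)^-1) `^ (- 2^-1) = ((1 - t ^+ 2) `^ (- 2^-1))^-1.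
  by rewrite -powRN -(powR_inv1 (ltW t2)) -powRrM; congr (_ `^ _); ring.
rewrite mulfK ?gt_eqF ?powR_gt0//.
by rewrite mulrDr mulr1 mulrAC [s * t]mulrC ts; field.
Qed.

(* At [x = sum_subst p] the factors combine through
   [x (s - x) = s^2 / (4 Q)] and [(1 + x) (1 + s - x) = (2 + s)^2 (1 + p^2) / (4 Q)],
   where [Q = 1 + (k p)^2]; the powers of [Q] then cancel. *)
Lemma sum_subst_integrand (a p : R) (x := sum_subst p) :
  x `^ (a - 1) / (1 + x) `^ (a + 1 / 2) *
  ((s - x) `^ (a - 1) / (1 + (s - x)) `^ (a + 1 / 2)) * sum_subst' p =
  2 * (1 + p ^+ 2) `^ (- (a + 1 / 2)) *
  (s `^ (2 * a - 1) * (2 + s) `^ (- (2 * a)) * (1 + s) `^ (- 2^-1)).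
Proof.
have sp := s0; have /andP[x0 xs] := sum_subst_itv p.
rewrite -/x in x0 xs.
set Q := 1 + (k * p) ^+ 2; have Qp : 0 < Q by exact: Q0.
have P0 : 0 < 1 + p ^+ 2 by rewrite ltr_pwDl// sqr_ge0.
have s1 : 0 < 1 + s by lra.
have s2 : 0 < 2 + s by lra.
have E1 : x * (s - x) = s ^+ 2 / 4 / Q.
  have -> : x * (s - x) = s ^+ 2 / 4 * (1 - t_ p ^+ 2).
    by rewrite /x /sum_subst -/(t_ p); field.
  by rewrite t_sqr -/Q subKr.
have k2 : k ^+ 2 = (2 + s) ^+ 2 / 4 / (1 + s).
  by rewrite /k exprMn sqr_powRN2V// expr_div_n; congr (_ / _ / _); ring.
(* The value of [k] is explained here: in [(1 + s) * Q + s ^+ 2 / 4] the constant term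
   [1 + s + s ^+ 2 / 4 = (2 + s) ^+ 2 / 4] equals the coefficient of [p ^+ 2], so [1 + p ^+ 2]
   splits off. *)
have E2 : (1 + x) * (1 + (s - x)) = (2 + s) ^+ 2 / 4 * (1 + p ^+ 2) / Q.
  have -> : (1 + x) * (1 + (s - x)) = 1 + s + x * (s - x) by ring.
  rewrite E1.
  have QE : Q = 1 + (2 + s) ^+ 2 / 4 / (1 + s) * p ^+ 2.
    by rewrite /Q exprMn k2.
  have : (1 + s) * Q = 1 + s + (2 + s) ^+ 2 / 4 * p ^+ 2.
    by rewrite QE; field; rewrite gt_eqF.
  move=> QE2.
  have -> : 1 + s + s ^+ 2 / 4 / Q = ((1 + s) * Q + s ^+ 2 / 4) / Q.
    by field; rewrite gt_eqF.
  by rewrite QE2; congr (_ / _); field.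
have -> : x `^ (a - 1) / (1 + x) `^ (a + 1 / 2) *
    ((s - x) `^ (a - 1) / (1 + (s - x)) `^ (a + 1 / 2)) =
    (s ^+ 2 / 4 / Q) `^ (a - 1) *
    ((2 + s) ^+ 2 / 4 * (1 + p ^+ 2) / Q) `^ (- (a + 1 / 2)).
  have y0 : 0 <= s - x by rewrite subr_ge0 ltW.
  rewrite -E1 -E2 powRN (powRM _ (ltW x0) y0) powRM; last 2 first.
  - by rewrite addr_ge0// ltW.
  - by rewrite addr_ge0.
  by rewrite invfM mulrACA.
rewrite /sum_subst' -/Q /k.
(* Every factor becomes an exponential, which leaves an identity between linear combinations of
   logarithms. The bases already produce [ln 4], so [2] is expressed through it to keep a single
   atom. *)
have two : 2 = expR (2^-1 * ln 4) :> R.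
  rewrite -gt0_powRE// powR12_sqrt//.
  by rewrite (_ : 4 = 2 ^+ 2); [rewrite sqrtr_sqr ger0_norm|ring].
have half : s / 2 = expR (ln s - 2^-1 * ln 4).
  by rewrite expRB lnK ?posrE// -two.
have half2 : (2 + s) / 2 = expR (ln (2 + s) - 2^-1 * ln 4).
  by rewrite expRB lnK ?posrE// -two.
rewrite half half2 [X in _ = X * _ * _]two.
rewrite !gt0_powRE//; last 2 first.
  by rewrite !divr_gt0 ?mulr_gt0 ?divr_gt0 ?exprn_gt0.
  by rewrite !divr_gt0 ?exprn_gt0.
rewrite !(ln_div, lnM, lnXn) ?posrE ?divr_gt0 ?mulr_gt0 ?exprn_gt0 ?divr_gt0//.
rewrite -!expRD; congr expR.
by move: (ln s) (ln 4) (ln Q) (ln (2 + s)) (ln (1 + s)) (ln (1 + p ^+ 2)) => *; field.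
Qed.

End sum_substitution.

(** * The substitution for the product integral *)

Section product_substitution.
Context {R : realType} (s : R).
Hypothesis s0 : 0 < s.

Let k : R := (1 + s) / (2 + s).

Let k0 : 0 < k.
Proof. by rewrite divr_gt0 ?addr_gt0. Qed.

(** The base of the square is the logistic function at [t + ln k]; the square undoes the root taken
    of the beta variable. *)
Definition prod_subst (t : R) : R := (k * expR t / (1 + k * expR t)) ^+ 2.

Definition prod_subst' (t : R) : R :=
  2 * (k * expR t) ^+ 2 / (1 + k * expR t) ^+ 3.

Let v0 t : 0 < k * expR t.
Proof. by rewrite mulr_gt0 ?expR_gt0. Qed.

Let D0 t : 0 < 1 + k * expR t.
Proof. by rewrite addr_gt0 ?v0. Qed.

Lemma is_derive_prod_subst (t : R) : is_derive t 1 prod_subst (prod_subst' t).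
Proof.
have D1 := lt0r_neq0 (D0 t).
have dV : is_derive t 1 (fun t => (1 + k * expR t)^-1)
    (- (k * expR t) / (1 + k * expR t) ^+ 2).
  apply: is_derive_eq; rewrite /GRing.scale/=.
  by move: (expR t) D1 => v ?; field.
rewrite /prod_subst; apply: is_derive_eq; rewrite /prod_subst' /GRing.scale/=.
by move: (expR t) D1 => v ?; field.
Qed.

Lemma continuous_prod_subst' : continuous prod_subst'.
Proof.
have ce : continuous (fun t : R => k * expR t).
  by move=> t; apply: cvgM; [exact: cvg_cst|exact: continuous_expR].
have cD : continuous (fun t : R => 1 + k * expR t).
  by move=> t; apply: cvgD; [exact: cvg_cst|exact: ce].
move=> t; apply: cvgM; [apply: cvgM; first exact: cvg_cst|].
  exact: (continuous_comp (ce t) (@exprn_continuous R 2 _)).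
apply: cvgV; first by rewrite expf_neq0// lt0r_neq0.
exact: (continuous_comp (cD t) (@exprn_continuous R 3 _)).
Qed.

Lemma prod_subst'_gt0 t : 0 < prod_subst' t.
Proof.
by apply: divr_gt0; [apply: mulr_gt0 => //; exact/exprn_gt0/v0|exact/exprn_gt0/D0].
Qed.

Let sg t : 0 < k * expR t / (1 + k * expR t) < 1.
Proof.
by rewrite divr_gt0 ?v0 ?D0//= ltr_pdivrMr ?D0// mul1r ltrDr.
Qed.

Lemma prod_subst_itv t : 0 < prod_subst t < 1.
Proof.
have /andP[g0 g1] := sg t.
by rewrite /prod_subst exprn_gt0//= exprn_ilt1// ltW.
Qed.

Lemma prod_subst_surj y : 0 < y < 1 -> exists t, prod_subst t = y.
Proof.
move=> /andP[y0 y1]; pose z := Num.sqrt y.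
have z0 : 0 < z by rewrite sqrtr_gt0.
have z1 : z < 1 by rewrite -sqrtr1 ltr_sqrt.
have zy : z ^+ 2 = y by rewrite sqr_sqrtr// ltW.
(* Solves [z = v / (1 + v)] by [v = z / (1 - z)], then [v = k * expR t] for [t]. *)
exists (ln (z / (1 - z) / k)).
rewrite /prod_subst lnK; last by rewrite posrE (divr_gt0 _ k0) ?divr_gt0 ?subr_gt0.
rewrite -zy; congr (_ ^+ 2); field.
by rewrite subrK oner_eq0 (gt_eqF k0) subr_eq0 (gt_eqF z1).
Qed.

(* With [w = sqrt z = v / (1 + v)], [v = k e^t], one has [1 - w = 1 / (1 + v)] and
   [1 + s + w = (1 + s) (1 + e^t) / (1 + v)]; the powers of [1 + w] cancel, and so
   do those of [1 + v]. *)
Lemma prod_subst_integrand (a t : R) (z := prod_subst t)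
    (y := s / (1 + Num.sqrt z)) :
  y `^ (2 * a - 1) / (1 + y) `^ (2 * a + 1 / 2) / (1 + Num.sqrt z) *
  (z `^ (a - 1) * (1 - z) `^ (1 / 2 - 1)) * prod_subst' t =
  2 * expR (2 * a * t) * (1 + expR t) `^ (- (2 * a + 1 / 2)) *
  (s `^ (2 * a - 1) * (2 + s) `^ (- (2 * a)) * (1 + s) `^ (- 2^-1)).
Proof.
have sp := s0.
set v := k * expR t; have vp : 0 < v by exact: v0.
set D := 1 + v; have Dp : 0 < D by exact: D0.
set w := v / D; have /andP[w0 w1] : 0 < w < 1 by exact: sg.
have zE : z = w ^+ 2 by [].
have szE : Num.sqrt z = w by rewrite zE sqrtr_sqr gtr0_norm.
rewrite /y szE.
have s1 : 0 < 1 + s by lra.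
have s2 : 0 < 2 + s by lra.
have e0 : 0 < 1 + expR t by rewrite addr_gt0 ?expR_gt0.
have ww : 0 < 1 + w by lra.
have Esw : 1 + s / (1 + w) = (1 + s) * (1 + expR t) / D / (1 + w).
  have -> : 1 + s / (1 + w) = (1 + s + w) / (1 + w) by field; rewrite gt_eqF.
  congr (_ / _); rewrite /w.
  have -> : 1 + s + v / D = ((1 + s) + (2 + s) * v) / D.
    by rewrite /D; field; rewrite gt_eqF.
  (* The choice of [k] enters through [(2 + s) * k = 1 + s], which makes the numerator a multiple of
     [1 + expR t]. *)
  congr (_ / _); rewrite /v /k; field; rewrite gt_eqF//.
have Ez : 1 - z = (1 + w) / D.
  by rewrite zE /w /D; field; rewrite gt_eqF.
have EF : prod_subst' t = 2 * v ^+ 2 / D ^+ 3 by [].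
rewrite EF Esw Ez zE.
have lnw : ln w = ln v - ln D by rewrite ln_div ?posrE.
(* After cancellation [v] survives with exponent [2 * a]; this splits it into [expR (2 * a * t)] and
   powers of [1 + s] and [2 + s]. *)
have lnv : ln v = ln (1 + s) - ln (2 + s) + t.
  by rewrite /v /k lnM ?posrE ?expR_gt0 ?divr_gt0// ln_div ?posrE// expRK.
rewrite -!powRN -(powR_inv1 (ltW ww)).
rewrite -[v ^+ 2]powR_mulrn ?ltW// -[D ^+ 3]powR_mulrn ?ltW// -powRN.
rewrite !gt0_powRE ?exprn_gt0 ?divr_gt0 ?mulr_gt0 ?divr_gt0//.
rewrite !(ln_div, lnM, lnXn) ?posrE ?divr_gt0 ?mulr_gt0 ?exprn_gt0 ?divr_gt0
  ?expR_gt0 ?invr_gt0// !expRK.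
have two : 2 = expR (ln 2) :> R by rewrite lnK ?posrE.
rewrite [X in _ * (X * _ * _) = _]two [X in _ = X * _ * _ * _]two -!expRD.
congr expR.
by move: (ln _) (ln _) (ln _) (ln _) (ln _) (ln _) (ln _) => *; field.
all: by rewrite ?expR_gt0 ?invr_gt0.
Qed.

End product_substitution.

(** * The law of an affine expression in one of two independent variables *)

Lemma ge0_measurable_funV d (T : measurableType d) (R : realType) (f : T -> R) :
  (forall x, 0 <= f x) -> measurable_fun [set: T] f ->
  measurable_fun [set: T] (fun x => (f x)^-1).
Proof.
move=> f0 mf.
(* The two functions agree at zeros of [f] as well, where both the inverse and the power take the
   value [0]. *)
rewrite (_ : (fun x => _) = fun x => f x `^ (-1)); last first.
  by apply/funext => x; rewrite powR_inv1.
exact: (measurableT_comp (measurable_powR _)).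
Qed.

(* [k (X) * Y + b (X)] covers both sides of the identity: [k = 1], [b = id] for the
   sum, and [k x = 1 + sqrt x], [b = 0] for the product. *)
Lemma law_affine_density (R : realType) d (T : measurableType d)
    (P : probability T R) (X Y : {RV P >-> R}) (f g k b : R -> R) :
  measurable_fun [set: R] f -> measurable_fun [set: R] g ->
  (forall x, 0 <= f x) -> (forall x, 0 <= g x) ->
  measurable_fun [set: R] k -> measurable_fun [set: R] b ->
  (forall x, 0 < k x) ->
  has_density P X f -> has_density P Y g -> indep2 P X Y ->
  forall A : set R, measurable A ->
  P ((fun w => k (X w) * Y w + b (X w)) @^-1` A) =
  (\int[@lebesgue_measure R]_s ((\1_A s)%:E *
    \int[@lebesgue_measure R]_x (g ((s - b x) / k x) / k x * f x)%:E))%E.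
Proof.
move=> mf mg f0 g0 mk mb k0 dX dY XY A mA.
pose T2 := (measurableTypeR R * measurableTypeR R)%type.
have m1 : measurable_fun [set: T2] (fst : T2 -> R) by exact: measurable_fst.
have m2 : measurable_fun [set: T2] (snd : T2 -> R) by exact: measurable_snd.
have mk1 : measurable_fun [set: T2] (fun z : T2 => k z.1) by exact: measurableT_comp.
have mb1 : measurable_fun [set: T2] (fun z : T2 => b z.1) by exact: measurableT_comp.
have mkV : measurable_fun [set: T2] (fun z : T2 => (k z.1)^-1).
  by apply: ge0_measurable_funV => // z; exact: ltW.
pose phi (z : T2) : R := k z.1 * z.2 + b z.1.
have mphi : measurable_fun [set: T2] phi.
  by apply: measurable_funD => //; exact: measurable_funM.
have mS : measurable (phi @^-1` A) by rewrite -[X in measurable X]setTI; exact: mphi.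
have := joint_law_density mf mg dX dY XY mS.
rewrite (_ : _ @^-1` (phi @^-1` A) = (fun w => k (X w) * Y w + b (X w)) @^-1` A)//.
move=> ->.
(* The integrand after the inner substitution [s = k x * y + b x], as a function on the plane.
   Tonelli then moves the integration over [s] outside. *)
pose h (z : T2) : \bar R :=
  ((\1_A z.2)%:E * (g ((z.2 - b z.1) / k z.1) / k z.1 * f z.1)%:E)%E.
have h0 z : (0 <= h z)%E.
  by rewrite /h -EFinM lee_fin !mulr_ge0// invr_ge0 ltW.
have mh : measurable_fun [set: T2] h.
  apply/measurable_EFinP; apply: measurable_funM.
    exact: (measurableT_comp (measurable_indic mA)).
  apply: measurable_funM; last exact: measurableT_comp.
  apply: measurable_funM => //; apply: measurableT_comp => //.
  by apply: measurable_funM => //; exact: measurable_funB.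
transitivity (\int[@lebesgue_measure R]_x \int[@lebesgue_measure R]_s h (x, s))%E.
  apply: eq_integral => x _.
  have mgx : measurable_fun [set: R] (fun s => \1_A s * g ((s - b x) / k x)).
    apply: measurable_funM; first exact: measurable_indic.
    apply: measurableT_comp => //.
    by apply: measurable_funM => //; exact: measurable_funB.
  have -> : (\int[@lebesgue_measure R]_y (\1_(phi @^-1` A) (x, y) * g y)%:E =
      \int[@lebesgue_measure R]_s ((k x)^-1%:E * (\1_A s * g ((s - b x) / k x))%:E))%E.
    rewrite -(@ge0_integral_affine _ (k x) (b x)
      (fun s => (\1_A s * g ((s - b x) / k x))%:E))//.
    - apply: eq_integral => y _; congr EFin.
      rewrite addrK [k x * y]mulrC mulfK ?gt_eqF//; congr (_ * _).
      by rewrite !indicE /= [y * k x]mulrC.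
    - exact/measurable_EFinP.
    - by move=> s; rewrite lee_fin mulr_ge0.
  rewrite -ge0_integralZr//.
  - apply: eq_integral => s _; rewrite /h/= -!EFinM; congr EFin.
    ring.
  - by apply/measurable_EFinP; exact: measurable_funM.
  - by move=> s _; rewrite -EFinM lee_fin !mulr_ge0// invr_ge0 ltW.
  - by rewrite lee_fin.
rewrite (@fubini_tonelli _ _ _ _ _ (@lebesgue_measure R) (@lebesgue_measure R) h)//.
apply: eq_integral => s _.
rewrite -ge0_integralZl//.
- apply/measurable_EFinP.
  have -> : (fun x => g ((s - b x) / k x) / k x * f x) =
     (fun z : T2 => g ((z.2 - b z.1) / k z.1) / k z.1 * f z.1) \o (fun x => (x, s)) by [].
  apply: measurableT_comp; last exact: measurable_pair2.
  apply: measurable_funM; last exact: measurableT_comp.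
  apply: measurable_funM => //; apply: measurableT_comp => //.
  by apply: measurable_funM => //; exact: measurable_funB.
- by move=> x _; rewrite lee_fin !mulr_ge0// invr_ge0 ltW.
Qed.

(** * Sign and measurability of the densities *)

(** The integrand is nonnegative and [fine] sends an infinite integral to [0], so the sign is
    settled before any question of convergence. *)
Lemma Gamma_ge0 (R : realType) (p : R) : 0 <= Gamma p.
Proof.
by apply/fine_ge0/integral_ge0 => x _; rewrite lee_fin mulr_ge0 ?powR_ge0 ?expR_ge0.
Qed.

Lemma beta_norm_ge0 (R : realType) (p q : R) :
  0 <= Gamma (p + q) / (Gamma p * Gamma q).
Proof. by rewrite divr_ge0 ?mulr_ge0 ?Gamma_ge0. Qed.

Lemma beta_density_ge0 (R : realType) (p q x : R) : 0 <= beta_density p q x.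
Proof.
rewrite /beta_density; case: ifP => // _.
by rewrite mulr_ge0 ?powR_ge0// mulr_ge0 ?powR_ge0// beta_norm_ge0.
Qed.

Lemma beta_prime_density_ge0 (R : realType) (p q x : R) :
  0 <= beta_prime_density p q x.
Proof.
rewrite /beta_prime_density; case: ifP => // _.
by rewrite divr_ge0 ?powR_ge0// mulr_ge0 ?powR_ge0// beta_norm_ge0.
Qed.

Lemma measurable_powR_onePx (R : realType) (r : R) :
  measurable_fun [set: R] (fun x => (1 + x) `^ r).
Proof.
by apply: (measurableT_comp (measurable_powR r)); exact: measurable_funD.
Qed.

Lemma measurable_beta_density (R : realType) (p q : R) :
  measurable_fun [set: R] (beta_density p q).
Proof.
apply: measurable_fun_ifT => //.
  by apply: measurable_and; exact: measurable_fun_ltr.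
apply: measurable_funM; first by apply: measurable_funM => //; exact: measurable_powR.
by apply: (measurableT_comp (measurable_powR _)); exact: measurable_funB.
Qed.

Lemma measurable_beta_prime_density (R : realType) (p q : R) :
  measurable_fun [set: R] (beta_prime_density p q).
Proof.
apply: measurable_fun_ifT => //; first exact: measurable_fun_ltr.
apply: measurable_funM; first by apply: measurable_funM => //; exact: measurable_powR.
by under eq_fun do rewrite -powRN; exact: measurable_powR_onePx.
Qed.

(** Left without a normalising constant, which the total mass fixes at the end. *)
Definition common_density {R : realType} (a s : R) : R :=
  if 0 < s then s `^ (2 * a - 1) * (2 + s) `^ (- (2 * a)) * (1 + s) `^ (- 2^-1)
  else 0.

Lemma common_density_ge0 (R : realType) (a s : R) : 0 <= common_density a s.
Proof. by rewrite /common_density; case: ifP => // _; rewrite !mulr_ge0 ?powR_ge0. Qed.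

Lemma measurable_common_density (R : realType) (a : R) :
  measurable_fun [set: R] (common_density a).
Proof.
apply: measurable_fun_ifT => //; first exact: measurable_fun_ltr.
apply: measurable_funM; last exact: measurable_powR_onePx.
apply: measurable_funM; first exact: measurable_powR.
by apply: (measurableT_comp (measurable_powR _)); exact: measurable_funD.
Qed.

Lemma continuous_powR (R : realType) (r x : R) : 0 < x ->
  {for x, continuous (fun y => y `^ r)}.
Proof.
move=> x0; apply/differentiable_continuous/derivable1_diffP.
by have [] := is_derive1_powR r x0.
Qed.

Lemma continuous_powR_comp (R : realType) (u : R -> R) (r x : R) :
  {for x, continuous u} -> 0 < u x -> {for x, continuous (fun y => u y `^ r)}.
Proof.
move=> cu u0.
exact: (@continuous_comp _ _ _ u (fun y => y `^ r) x cu (continuous_powR u0)).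
Qed.

(** * Separation of the two integrals into a constant times the common density *)

(** The substitution makes the integrand a product of a function of [p] and one of [s]; [C] is the
    integral of the former, kept in [\bar R] so that its finiteness stays open. The divisions by [1]
    match the affine form with [k = 1]. *)
Lemma sum_integral (R : realType) (a : R) : exists2 C : \bar R, (0 <= C)%E &
  forall s, (\int[@lebesgue_measure R]_x
    (beta_prime_density a (1 / 2) ((s - x) / 1) / 1 * beta_prime_density a (1 / 2) x)%:E
    = C * (common_density a s)%:E)%E.
Proof.
pose c : R := Gamma (a + 1 / 2) / (Gamma a * Gamma (1 / 2)).
have c0 : 0 <= c by exact: beta_norm_ge0.
pose w p : R := c ^+ 2 * (2 * (1 + p ^+ 2) `^ (- (a + 1 / 2))).
have w0 p : 0 <= w p by rewrite mulr_ge0 ?sqr_ge0// mulr_ge0 ?powR_ge0.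
exists (\int[@lebesgue_measure R]_p (w p)%:E)%E.
  by apply: integral_ge0 => p _; rewrite lee_fin.
move=> s; rewrite /common_density; case: ifPn => [s0|sN0]; last first.
  (* For [s <= 0] the numbers [x] and [s - x] cannot both be positive, so one of the densities
     vanishes. *)
  rewrite mule0; apply: integral0_eq => x _; congr EFin.
  rewrite !divr1 /beta_prime_density.
  case: ifPn => [sx|_]; last by rewrite mul0r.
  case: ifPn => [x0|_]; last by rewrite mulr0.
  by move: sN0 sx; rewrite subr_gt0 => /negP sN0 /(lt_trans x0).
pose h x := c ^+ 2 * (x `^ (a - 1) / (1 + x) `^ (a + 1 / 2) *
  ((s - x) `^ (a - 1) / (1 + (s - x)) `^ (a + 1 / 2))).
transitivity (\int[@lebesgue_measure R]_(x in `]0%R, s[) (h x)%:E)%E.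
  rewrite [RHS]integral_mkcond; apply: eq_integral => x _.
  rewrite patchE mem_setE in_itv/= !divr1 /beta_prime_density subr_gt0.
  case: ifPn => [xs|]; last by rewrite mul0r andbF.
  case: ifPn => [x0|]; last by rewrite mulr0.
  by rewrite /h/= -/c; congr EFin; ring.
rewrite (@ge0_integration_by_substitution_range _ _ _ h 0 s (is_derive_sum_subst s)).
- rewrite -ge0_integralZr//.
  + apply: eq_integral => p _; rewrite -EFinM; congr EFin.
    by rewrite /h -mulrA sum_subst_integrand// /w; ring.
  + apply/measurable_EFinP; apply: measurable_funM => //; apply: measurable_funM => //.
    apply: (measurableT_comp (measurable_powR _)); exact: measurable_funD.
  + by move=> p _; rewrite lee_fin.
  + by rewrite lee_fin !mulr_ge0 ?powR_ge0.
- exact: continuous_sum_subst'.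
- exact: sum_subst'_gt0.
- exact: sum_subst_itv.
- exact: sum_subst_surj.
- move=> x; rewrite in_itv/= => /andP[x0 xs].
  have cs : {for x, continuous (fun x => s - x)}.
    by apply: cvgB; [exact: cvg_cst|exact: cvg_id].
  apply: cvgM; first exact: cvg_cst.
  have x10 : 0 < 1 + x by rewrite addr_gt0.
  have sx0 : 0 < s - x by rewrite subr_gt0.
  have sx10 : 0 < 1 + (s - x) by rewrite addr_gt0.
  apply: cvgM.
    apply: cvgM; first exact: continuous_powR.
    apply: cvgV; first by rewrite lt0r_neq0// powR_gt0.
    apply: continuous_powR_comp => //.
    by apply: cvgD; [exact: cvg_cst|exact: cvg_id].
  apply: cvgM; first exact: (@continuous_powR_comp _ (fun x => s - x)).
  apply: cvgV; first by rewrite lt0r_neq0// powR_gt0.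
  apply: (@continuous_powR_comp _ (fun x => 1 + (s - x))) => //.
  by apply: cvgD; [exact: cvg_cst|exact: cs].
- by move=> x _; rewrite mulr_ge0 ?sqr_ge0// !mulr_ge0 ?invr_ge0 ?powR_ge0.
Qed.

(** Same scheme with the logistic substitution, conditioning on the beta variable; [s - 0] matches
    the affine form with [b = 0]. *)
Lemma prod_integral (R : realType) (a : R) : exists2 C : \bar R, (0 <= C)%E &
  forall s, (\int[@lebesgue_measure R]_x
    (beta_prime_density (2 * a) (1 / 2) ((s - 0) / (1 + Num.sqrt x)) / (1 + Num.sqrt x) *
     beta_density a (1 / 2) x)%:E = C * (common_density a s)%:E)%E.
Proof.
pose c : R := Gamma (2 * a + 1 / 2) / (Gamma (2 * a) * Gamma (1 / 2)) *
  (Gamma (a + 1 / 2) / (Gamma a * Gamma (1 / 2))).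
have c0 : 0 <= c by rewrite /c (mulr_ge0 (beta_norm_ge0 _ _) (beta_norm_ge0 _ _)).
pose w t : R := c * (2 * expR (2 * a * t) * (1 + expR t) `^ (- (2 * a + 1 / 2))).
have w0 t : 0 <= w t.
  by rewrite mulr_ge0 // mulr_ge0 ?powR_ge0// mulr_ge0 ?expR_ge0.
exists (\int[@lebesgue_measure R]_t (w t)%:E)%E.
  by apply: integral_ge0 => t _; rewrite lee_fin.
move=> s; rewrite /common_density.
(* This covers negative [x] too, since [Num.sqrt] is [0] there. *)
have k0 x : 0 < 1 + Num.sqrt x :> R by rewrite ltr_pwDl ?sqrtr_ge0.
case: ifPn => [s0|sN0]; last first.
  rewrite mule0; apply: integral0_eq => x _; congr EFin.
  rewrite subr0 /beta_prime_density ltr_pdivlMr// mul0r (negbTE sN0).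
  by rewrite !mul0r.
pose y x := s / (1 + Num.sqrt x).
pose h x := c * (y x `^ (2 * a - 1) / (1 + y x) `^ (2 * a + 1 / 2) / (1 + Num.sqrt x) *
  (x `^ (a - 1) * (1 - x) `^ (1 / 2 - 1))).
transitivity (\int[@lebesgue_measure R]_(x in `]0%R, 1%R[) (h x)%:E)%E.
  rewrite [RHS]integral_mkcond; apply: eq_integral => x _.
  rewrite patchE mem_setE in_itv/= subr0 /beta_prime_density /beta_density divr_gt0//.
  case: ifPn => [_|]; last by rewrite mulr0.
  by rewrite /h /c /y; congr EFin; ring.
rewrite (@ge0_integration_by_substitution_range _ _ _ h 0 1 (is_derive_prod_subst s0)).
- rewrite -ge0_integralZr//.
  + apply: eq_integral => t _; rewrite -EFinM; congr EFin.
    by rewrite /h -mulrA prod_subst_integrand// /w; ring.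
  + apply/measurable_EFinP; apply: measurable_funM => //; apply: measurable_funM => //.
      by apply: measurable_funM => //; apply: measurableT_comp.
    by apply: (measurableT_comp (measurable_powR_onePx _)).
  + by move=> t _; rewrite lee_fin.
  + by rewrite lee_fin !mulr_ge0 ?powR_ge0.
- exact: continuous_prod_subst'.
- exact: prod_subst'_gt0.
- exact: prod_subst_itv.
- exact: prod_subst_surj.
- move=> x; rewrite in_itv/= => /andP[x0 x1].
  have ck : {for x, continuous (fun x => 1 + Num.sqrt x)}.
    by apply: cvgD; [exact: cvg_cst|exact: sqrt_continuous].
  have ckV : {for x, continuous (fun x => (1 + Num.sqrt x)^-1)}.
    by apply: cvgV => //; rewrite gt_eqF.
  have cy : {for x, continuous y} by apply: cvgM; [exact: cvg_cst|exact: ckV].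
  have y0 : 0 < y x by rewrite divr_gt0.
  apply: cvgM; first exact: cvg_cst.
  apply: cvgM.
    apply: cvgM; last exact: ckV.
    apply: cvgM; first exact: (@continuous_powR_comp _ y).
    apply: cvgV; first by rewrite lt0r_neq0// powR_gt0// addr_gt0.
    apply: (@continuous_powR_comp _ (fun x => 1 + y x)); last by rewrite addr_gt0.
    by apply: cvgD; [exact: cvg_cst|exact: cy].
  apply: cvgM; first exact: continuous_powR.
  apply: (@continuous_powR_comp _ (fun x => 1 - x)); last by rewrite subr_gt0.
  by apply: cvgB; [exact: cvg_cst|exact: cvg_id].
- by move=> x _; rewrite mulr_ge0// !mulr_ge0 ?invr_ge0 ?powR_ge0.
Qed.

(** * Comparison of the constants and conclusion *)

(** A product equal to [1] excludes [I = 0] and [I = +oo], as they give only [0] or [+oo]; for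
    finite positive [I] both constants are its inverse. This is where finiteness of the constants
    comes out. *)
Lemma mule_eq1_inj (R : realType) (C D I : \bar R) : (0 <= C)%E -> (0 <= D)%E ->
  (0 <= I)%E -> (C * I = 1)%E -> (D * I = 1)%E -> C = D.
Proof.
move=> C0 D0; case: I => [r| |]//.
  rewrite lee_fin le_eqVlt => /predU1P[<-|r0].
    by rewrite mule0 => /eqP; rewrite eqe eq_sym oner_eq0.
  have E X : (0 <= X)%E -> (X * r%:E = 1)%E -> X = r^-1%:E.
    case: X => [x| |]// _; last by rewrite gt0_mulye.
    by move=> [xr]; congr EFin; apply: (mulIf (lt0r_neq0 r0)); rewrite xr mulVf ?gt_eqF.
  by move=> /(E _ C0) -> /(E _ D0) ->.
move: C0; rewrite le_eqVlt => /predU1P[<-|C0] _.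
  by rewrite mul0e => /eqP; rewrite eqe eq_sym oner_eq0.
by rewrite gt0_muley.
Qed.

(** Once the inner integral separates, [C] leaves the outer one, and the law is [C] times a measure
    that depends on [a] alone. *)
Lemma law_common_density (R : realType) d (T : measurableType d)
    (P : probability T R) (X Y : {RV P >-> R}) (f g k b : R -> R) (a : R) (C : \bar R) :
  measurable_fun [set: R] f -> measurable_fun [set: R] g ->
  (forall x, 0 <= f x) -> (forall x, 0 <= g x) ->
  measurable_fun [set: R] k -> measurable_fun [set: R] b ->
  (forall x, 0 < k x) ->
  has_density P X f -> has_density P Y g -> indep2 P X Y -> (0 <= C)%E ->
  (forall s, (\int[@lebesgue_measure R]_x (g ((s - b x) / k x) / k x * f x)%:E
    = C * (common_density a s)%:E)%E) ->
  forall A : set R, measurable A ->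
  P ((fun w => k (X w) * Y w + b (X w)) @^-1` A) =
  (C * \int[@lebesgue_measure R]_s (\1_A s * common_density a s)%:E)%E.
Proof.
move=> mf mg f0 g0 mk mb k0 dX dY XY C0 CE A mA.
rewrite (law_affine_density mf mg)// -ge0_integralZl//.
- by apply: eq_integral => s _; rewrite CE muleCA EFinM.
- apply/measurable_EFinP; apply: measurable_funM; first exact: measurable_indic.
  exact: measurable_common_density.
- by move=> s _; rewrite lee_fin mulr_ge0 ?common_density_ge0.
Qed.

Theorem theoremA (R : realType) (a : R) (ha : 0 < a)
  (d1 : measure_display) (T1 : measurableType d1) (P1 : probability T1 R)
  (X1 X2 : {RV P1 >-> R})
  (d2 : measure_display) (T2 : measurableType d2) (P2 : probability T2 R)
  (Y Z : {RV P2 >-> R}) :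
  has_density P1 X1 (beta_prime_density a (1 / 2)) ->
  has_density P1 X2 (beta_prime_density a (1 / 2)) ->
  indep2 P1 X1 X2 ->
  has_density P2 Y (beta_prime_density (2 * a) (1 / 2)) ->
  has_density P2 Z (beta_density a (1 / 2)) ->
  indep2 P2 Y Z ->
  forall A : set R, measurable A ->
    P1 ((fun w => X1 w + X2 w) @^-1` A) =
    P2 ((fun w => Y w * (1 + Num.sqrt (Z w))) @^-1` A).
Proof.
move=> dX1 dX2 X12 dY dZ YZ A mA.
have [C1 C10 C1E] := @sum_integral R a.
have [C2 C20 C2E] := @prod_integral R a.
have law1 B : measurable B -> P1 ((fun w => X1 w + X2 w) @^-1` B) =
    (C1 * \int[@lebesgue_measure R]_s (\1_B s * common_density a s)%:E)%E.
  move=> mB; rewrite -(law_common_density (k := fun=> 1) (b := id) (X := X1)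
    (measurable_beta_prime_density _ _) (measurable_beta_prime_density _ _)
    (@beta_prime_density_ge0 _ _ _) (@beta_prime_density_ge0 _ _ _) _ _ _ dX1 dX2)//.
  by congr (P1 (_ @^-1` B)); apply/funext => w; rewrite mul1r addrC.
(* The affine coefficients are functions of the first variable of the pair, so the beta variable has
   to come first. *)
have ZY : indep2 P2 Z Y by move=> B D mB mD; rewrite setIC muleC; exact: YZ.
have law2 B : measurable B -> P2 ((fun w => Y w * (1 + Num.sqrt (Z w))) @^-1` B) =
    (C2 * \int[@lebesgue_measure R]_s (\1_B s * common_density a s)%:E)%E.
  move=> mB; rewrite -(law_common_density (k := fun x => 1 + Num.sqrt x)
    (b := fun=> 0) (X := Z)
    (measurable_beta_density _ _) (measurable_beta_prime_density _ _)
    (@beta_density_ge0 _ _ _) (@beta_prime_density_ge0 _ _ _) _ _ _ dZ dY)//.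
  - by congr (P2 (_ @^-1` B)); apply/funext => w; rewrite addr0 mulrC.
  - apply: measurable_funD => //.
    exact: (continuous_measurable_fun (@sqrt_continuous R)).
(* Evaluating both laws on the whole line gives two equations with the same integral, which force
   [C1 = C2]. *)
have mass1 : (C1 * \int[@lebesgue_measure R]_s (\1_setT s * common_density a s)%:E = 1)%E.
  by rewrite -law1// preimage_setT probability_setT.
have mass2 : (C2 * \int[@lebesgue_measure R]_s (\1_setT s * common_density a s)%:E = 1)%E.
  by rewrite -law2// preimage_setT probability_setT.
rewrite law1// law2//; congr (_ * _)%E; apply: mule_eq1_inj mass1 mass2 => //.
by apply: integral_ge0 => s _; rewrite lee_fin mulr_ge0 ?common_density_ge0.
Qed.
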